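(* Let $n$ be a composite integer and let $n=p_1p_2\cdots p_m$ with $m\geq 2$ and all $p_i\geq 2$. Let $\mathcal G$ be a nonempty simple undirected graph on $n$ vertices. Then the normalized Laplacian matrix of $\mathcal G$ is separable in $\mathbb{C}^{p_1}\otimes\mathbb{C}^{p_2}\otimes\cdots\otimes\mathbb{C}^{p_m}$ for every vertex labeling if and only if $\mathcal G$ is the complete graph $K_n$, or $n=4$ (so $m=2$, $p_1=p_2=2$) and $\mathcal G$ is isomorphic to the complete bipartite graph $K_{2,2}$ or to its complement $\overline{K_{2,2}}$ (two disjoint edges).
   Context: A complex matrix is a density matrix if it is Hermitian, positive semidefinite and has trace $1$. The Laplacian matrix of a graph is $L=D-A$, where $D$ is the diagonal matrix of vertex degrees and $A$ the adjacency matrix; a graph is nonempty if it has at least one edge, and then its normalized Laplacian matrix $\frac{1}{\mathrm{tr}(L)}L$ is a density matrix. For $n=p_1\cdots p_m$, a vertex labeling is a bijection between the vertex set $\{1,\dots,n\}$ and $\{1,\dots,p_1\}\times\cdots\times\{1,\dots,p_m\}$; under a labeling, the vertex labeled $(a_1,\dots,a_m)$ is identified with the standard basis vector $e_{a_1}\otimes\cdots\otimes e_{a_m}$ of $\mathbb{C}^{p_1}\otimes\cdots\otimes\mathbb{C}^{p_m}$, so that the (normalized) Laplacian becomes an operator on this tensor product space (its separability thus depends on the labeling). A density matrix $\rho$ on $\mathbb{C}^{p_1}\otimes\cdots\otimes\mathbb{C}^{p_m}$ is separable if it can be written as $\rho=\sum_i c_i A_i^1\otimes\cdots\otimes A_i^m$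 with $c_i\geq 0$, $\sum_i c_i=1$, and each $A_i^j$ a density matrix in $\mathbb{C}^{p_j\times p_j}$; otherwise it is entangled. *)

(* Defs.v *)
From mathcomp Require Import all_boot all_algebra.
From mathcomp Require Import complex.
From mathcomp Require Import Rstruct.
Set Implicit Arguments. Unset Strict Implicit. Unset Printing Implicit Defensive.
Import GRing.Theory Num.Theory.
Local Open Scope ring_scope.

Definition C : numClosedFieldType := (Rdefinitions.R)[i].

Definition op (T : finType) := T -> T -> C.

Definition hermitian (T : finType) (M : op T) : Prop :=
  forall x y, M x y = (M y x)^*.
Definition psd (T : finType) (M : op T) : Prop :=
  forall v : T -> C, 0 <= \sum_(x : T) \sum_(y : T) (v x)^* * M x y * v y.
Definition trace (T : finType) (M : op T) : C := \sum_(x : T) M x x.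
Definition density_matrix (T : finType) (M : op T) : Prop :=
  [/\ hermitian M, psd M & trace M = 1].

(* The index set {1..p_1} x ... x {1..p_m} (0-based): basis of C^{p_1}⊗...⊗C^{p_m}. *)
Definition prodIdx (m : nat) (p : 'I_m -> nat) : finType :=
  {dffun forall j : 'I_m, 'I_(p j)}.

Definition tens (m : nat) (p : 'I_m -> nat) (A : forall j : 'I_m, op 'I_(p j))
  : op (prodIdx p) := fun a b => \prod_(j : 'I_m) A j (a j) (b j).

Definition separable (m : nat) (p : 'I_m -> nat) (rho : op (prodIdx p)) : Prop :=
  exists (k : nat) (c : 'I_k -> C) (A : 'I_k -> forall j : 'I_m, op 'I_(p j)),
    [/\ forall i, 0 <= c i,
        \sum_(i < k) c i = 1,
        forall i j, density_matrix (A i j) &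
        forall a b, rho a b = \sum_(i < k) c i * tens (A i) a b].

Definition simple_graph (n : nat) (e : rel 'I_n) : Prop :=
  symmetric e /\ irreflexive e.
Definition nonempty_graph (n : nat) (e : rel 'I_n) : Prop :=
  exists x y, e x y.
Definition degree (n : nat) (e : rel 'I_n) (x : 'I_n) : nat := #|[set y | e x y]|.
Definition laplacian (n : nat) (e : rel 'I_n) : op 'I_n :=
  fun x y => (if x == y then (degree e x)%:R else 0) - (e x y)%:R.
Definition normalized_laplacian (n : nat) (e : rel 'I_n) : op 'I_n :=
  fun x y => laplacian e x y / trace (laplacian e).

(* The operator on the tensor product space obtained from a vertex labeling;
   lab : prodIdx p -> 'I_n is a bijection (vertex labeled a is lab a). *)
Definition labeled_op (n m : nat) (p : 'I_m -> nat) (lab : prodIdx p -> 'I_n)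
  (M : op 'I_n) : op (prodIdx p) := fun a b => M (lab a) (lab b).

Definition complete_graph (n : nat) (e : rel 'I_n) : Prop :=
  forall x y, x != y -> e x y.

Definition K22 : rel 'I_4 := fun x y => (x < 2)%N != (y < 2)%N.
Definition coK22 : rel 'I_4 := fun x y => (x != y) && ((x < 2)%N == (y < 2)%N).

Definition isomorphic (n : nat) (e f : rel 'I_n) : Prop :=
  exists g : 'I_n -> 'I_n, bijective g /\ forall x y, e (g x) (g y) = f x y.

(* Main.v *)
(* If the Laplacian L is separable then, since the all-ones vector 1 annihilates
   L, each product state of the decomposition has a factor annihilating the
   all-ones vector of its space; hence the partial transpose of L also kills 1.
   Read off at a vertex v of the grid p_1 x (p_2 ... p_m), this says that v has
   as many neighbours outside its row and column as there are edges between the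
   rest of its row and the rest of its column.  Comparing labelings that differ
   by two transpositions makes the adjacency relation constant as soon as two
   vertices lie outside the row and column of v; on the 2 x 2 grid it only
   forces opposite edges to be simultaneously present.

   Conversely, with P_j the projection onto the all-ones vector, the Laplacian
   of K_n is a multiple of 1 - P_1 (x) ... (x) P_m, which telescopes into product
   operators; on C^2 (x) C^2 the three pairs of opposite edges contribute
   1 (x) Q, Q (x) 1 and (P (x) Q + Q (x) P) / 2 up to scaling, with Q = 1 - P. *)
From mathcomp Require Import all_boot all_order all_algebra all_fingroup.
From mathcomp Require Import ring zify.
Require Import Defs.
Set Implicit Arguments. Unset Strict Implicit. Unset Printing Implicit Defensive.
Import Order.TTheory GRing.Theory Num.Theory.
Local Open Scope ring_scope.

(* Otherwise unification unfolds C to R[i] and loses its ring structures. *)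
Local Opaque C.

(** * Positive semidefinite operators and the all-ones vector *)

Lemma psd_sum_ge0 (T : finType) (M : op T) :
  psd M -> 0 <= \sum_x \sum_y M x y.
Proof.
move=> /(_ (fun=> 1)); congr (0 <= _).
by apply: eq_bigr => x _; apply: eq_bigr => y _; rewrite rmorph1 mul1r mulr1.
Qed.

Lemma hermitian_col_sum (T : finType) (M : op T) (x : T) :
  hermitian M -> \sum_y M y x = (\sum_y M x y)^*.
Proof. by move=> hM; rewrite rmorph_sum; apply: eq_bigr => y _; apply: hM. Qed.

Lemma sum_mul_delta (T : finType) (z : T) (F : T -> C) :
  \sum_x F x * (x == z)%:R = F z.
Proof.
rewrite (bigD1 z) //= eqxx mulr1 big1 ?addr0 // => x /negbTE ->.
by rewrite mulr0.
Qed.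

(** If the row sum were nonzero, moving the all-ones vector slightly along the basis vector at [z]
    would change the form to first order and could make it negative. *)
Lemma psd_row_sum_eq0 (T : finType) (M : op T) (z : T) :
  hermitian M -> psd M -> \sum_x \sum_y M x y = 0 -> \sum_y M z y = 0.
Proof.
move=> hM pM s0; set r := \sum_y M z y.
have Mzz : 0 <= M z z.
  move: (pM (fun x => (x == z)%:R)); congr (0 <= _).
  rewrite (eq_bigr (fun x => M x z * (x == z)%:R)) ?sum_mul_delta // => x _.
  by rewrite sum_mul_delta rmorph_nat mulrC.
pose K := 1 + M z z.
have K_real : K^* = K by apply/CrealP; rewrite ger0_real // addr_ge0.
have row x : \sum_y (M x y * (K - r * (y == z)%:R))
             = K * (\sum_y M x y) - r * M x z.
  rewrite mulr_sumr -(sum_mul_delta z (fun y => M x y)) mulr_sumr -sumrB.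
  by apply: eq_bigr => y _; ring.
(* The trial vector K 1 - r e_z makes the form equal to -|r|^2 (2 + M z z). *)
have := pM (fun x => K - r * (x == z)%:R).
have -> : \sum_x \sum_y (K - r * (x == z)%:R)^* * M x y * (K - r * (y == z)%:R)
          = - (r * r^* * (2 + M z z)).
  transitivity (\sum_x (K * K * (\sum_y M x y) - K * r * M x z
     - (r^* * (K * (\sum_y M x y) - r * M x z)) * (x == z)%:R)).
    apply: eq_bigr => x _.
    under eq_bigr do rewrite -mulrA.
    rewrite -mulr_sumr row rmorphB /= rmorphM /= rmorph_nat K_real; ring.
  rewrite !sumrB sum_mul_delta -!mulr_sumr s0 hermitian_col_sum // -/r /K; ring.
rewrite oppr_ge0 => le0; apply/eqP; move: le0.
rewrite pmulr_lle0; last by rewrite ltr_wpDr.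
by move=> le0; rewrite -mul_conjC_eq0 eq_le le0 mul_conjC_ge0.
Qed.

(** * Product operators and the partial transpose *)

Lemma sum_dffun_prod (R : comPzSemiRingType) (I : finType) (T : I -> finType)
    (F : forall i, T i -> R) :
  \sum_(a : {dffun forall i, T i}) \prod_i F i (a i) = \prod_i \sum_x F i x.
Proof.
rewrite (reindex (@dffun_of_fprod I T)); last exact/onW_bij/dffun_of_fprod_bij.
transitivity (\sum_(t : fprod T) \prod_(i in I) [ffun x => F i x] (t i)).
  by apply: eq_bigr => t _; apply: eq_bigr => i _; rewrite !ffunE.
rewrite big_fprod.
(* The default [0] of [untag] is never read: [tagged_with T i] keeps only elements with tag [i]. *)
rewrite -(bigA_distr_big_dep (fun i => tagged_with T i)
            (fun i j => untag 0 [ffun x => F i x] j)).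
apply: eq_bigr => i _; rewrite -(big_tag (fun i => [ffun x => F i x])).
by apply: eq_bigr => x _; rewrite ffunE.
Qed.

Lemma tens_total (m : nat) (p : 'I_m -> nat) (A : forall j, op 'I_(p j)) :
  \sum_(a : prodIdx p) \sum_b tens A a b = \prod_j \sum_x \sum_y A j x y.
Proof.
transitivity (\sum_(a : prodIdx p) \prod_j \sum_y A j (a j) y).
  by apply: eq_bigr => a _; apply: (sum_dffun_prod (fun j y => A j (a j) y)).
exact: (sum_dffun_prod (fun j x => \sum_y A j x y)).
Qed.

Definition with_coord (m : nat) (p : 'I_m -> nat) (j0 : 'I_m) (a b : prodIdx p) :
  prodIdx p := [ffun j => if j == j0 then b j else a j].

(* The expression [rho (with_coord j0 a b) (with_coord j0 b a)] is the (a, b)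
   entry of the partial transpose of rho in the factor j0. *)
Lemma separable_partial_transpose (m : nat) (p : 'I_m -> nat)
    (rho : op (prodIdx p)) (j0 : 'I_m) (a : prodIdx p) :
  separable rho -> \sum_a \sum_b rho a b = 0 ->
  \sum_b rho (with_coord j0 a b) (with_coord j0 b a) = 0.
Proof.
case=> k [c [A [c_ge0 _ dens rhoE]]] tot0.
(* [s i] is the sum of all entries of the [i]-th product state. These sums are nonnegative and their
   weighted total is that of [rho], so each [c i * s i] vanishes. *)
pose s i := \prod_j \sum_x \sum_y A i j x y.
have s_ge0 i : 0 <= s i.
  by apply: prodr_ge0 => j _; case: (dens i j) => _ /psd_sum_ge0.
have cs0 : \sum_i c i * s i = 0.
  rewrite -[RHS]tot0.
  under eq_bigr do rewrite /s -tens_total mulr_sumr.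
  rewrite exchange_big; apply: eq_bigr => x _ /=.
  under eq_bigr do rewrite mulr_sumr.
  by rewrite exchange_big; apply: eq_bigr => y _; rewrite rhoE.
transitivity (\sum_i c i * \sum_b tens (A i) (with_coord j0 a b) (with_coord j0 b a)).
  under eq_bigr do rewrite rhoE.
  by rewrite exchange_big; apply: eq_bigr => i _; rewrite mulr_sumr.
rewrite big1 // => i _.
have /eqP : c i * s i = 0.
  by apply: psumr_eq0P cs0 _ _ => // i' _; apply: mulr_ge0.
rewrite mulf_eq0 => /orP[/eqP->|/prodf_eq0[j _ /eqP sj]]; first by rewrite mul0r.
(* The row sum of a transposed product factors into a column sum at [j0] and row sums elsewhere. The
   factor [j], whose entries sum to zero, contributes [0] in either case. *)
pose F j' y := if j' == j0 then A i j' y (a j') else A i j' (a j') y.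
suff -> : \sum_b tens (A i) (with_coord j0 a b) (with_coord j0 b a)
          = \prod_j' \sum_y F j' y.
  case: (dens i j) => hA pA _.
  rewrite (bigD1 j) //= /F; case: eqP => _.
    by rewrite hermitian_col_sum // psd_row_sum_eq0 // rmorph0 mul0r mulr0.
  by rewrite psd_row_sum_eq0 // mul0r mulr0.
rewrite -sum_dffun_prod; apply: eq_bigr => b _; apply: eq_bigr => j' _.
by rewrite /F !ffunE; case: eqP.
Qed.

(** * Laplacians and the degree condition for separability *)

Lemma degreeE (n : nat) (e : rel 'I_n) (x : 'I_n) :
  degree e x = (\sum_y e x y)%N.
Proof.
by rewrite /degree -sum1dep_card big_mkcond; apply: eq_bigr => y _; case: e.
Qed.

Lemma laplacian_row_sum (n : nat) (e : rel 'I_n) (x : 'I_n) :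
  \sum_y laplacian e x y = 0.
Proof.
rewrite sumrB (eq_bigr (fun y => (degree e x)%:R * (y == x)%:R)); last first.
  by move=> y _; rewrite eq_sym; case: eqP => _; rewrite ?mulr1 ?mulr0.
by rewrite (sum_mul_delta x (fun=> _)) degreeE natr_sum subrr.
Qed.

Lemma laplacian_trace (n : nat) (e : rel 'I_n) :
  irreflexive e -> trace (laplacian e) = (\sum_x degree e x)%:R.
Proof.
move=> e_irr; rewrite natr_sum; apply: eq_bigr => x _.
by rewrite /laplacian eqxx e_irr subr0.
Qed.

Lemma laplacian_trace_neq0 (n : nat) (e : rel 'I_n) :
  irreflexive e -> nonempty_graph e -> trace (laplacian e) != 0.
Proof.
move=> e_irr [x [y exy]]; rewrite laplacian_trace // pnatr_eq0 -lt0n.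
by rewrite (bigD1 x) //= degreeE (bigD1 y) //= exy.
Qed.

Lemma with_coord_eq (m : nat) (p : 'I_m -> nat) (j0 : 'I_m) (a b : prodIdx p) :
  (with_coord j0 a b == with_coord j0 b a) = (b == a).
Proof.
apply/eqP/eqP => [/ffunP eq_ab|->//]; apply/ffunP => j.
by have := eq_ab j; rewrite !ffunE; case: eqP => _ // <-.
Qed.

(** The rows of the partial transpose sum to zero. Partial transposition keeps the diagonal in
    place, so row [a] consists of the degree of [lab a] minus the edge terms on the right. *)
Lemma separable_degree (n m : nat) (p : 'I_m -> nat) (e : rel 'I_n)
    (lab : prodIdx p -> 'I_n) (j0 : 'I_m) (a : prodIdx p) :
  simple_graph e -> nonempty_graph e -> bijective lab ->
  separable (labeled_op lab (normalized_laplacian e)) ->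
  (\sum_b e (lab a) (lab b)
   = \sum_b e (lab (with_coord j0 a b)) (lab (with_coord j0 b a)))%N.
Proof.
move=> [_ e_irr] e_ne lab_bij sep.
have tr_neq0 := laplacian_trace_neq0 e_irr e_ne.
have rows0 c : \sum_b labeled_op lab (normalized_laplacian e) c b = 0.
  transitivity ((\sum_y laplacian e (lab c) y) / trace (laplacian e)).
    by rewrite mulr_suml [RHS](reindex lab) //; exact/onW_bij/lab_bij.
  by rewrite laplacian_row_sum mul0r.
have := separable_partial_transpose j0 a sep.
rewrite (eq_bigr (fun=> 0)) // sumr_const mul0rn => /(_ erefl).
rewrite -mulr_suml => /eqP; rewrite mulf_eq0 invr_eq0 (negbTE tr_neq0) orbF.
rewrite sumrB (eq_bigr (fun b => (degree e (lab a))%:R * (b == a)%:R)); last first.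
  move=> b _; rewrite (bij_eq lab_bij) with_coord_eq.
  case: eqP => [->|_]; rewrite ?mulr0 ?mulr1 //.
  by congr (degree e (lab _))%:R; apply/ffunP => j; rewrite ffunE if_same.
rewrite (sum_mul_delta a (fun=> _)) subr_eq0 degreeE -natr_sum eqr_nat => /eqP <-.
by rewrite (reindex lab) //; exact/onW_bij/lab_bij.
Qed.

(** * Labelings with prescribed values *)

(** Induction on the lists: a transposition after [f] corrects the value at the head and fixes the
    values on the tail. This lets chosen grid positions carry any chosen distinct vertices. *)
Lemma exists_bijection_map (T V : finType) (s : seq T) (t : seq V) :
  #|T| = #|V| -> uniq s -> uniq t -> size s = size t ->
  exists2 f : T -> V, bijective f & map f s = t.
Proof.
move=> eqTV; elim: s t => [|x s IHs] [|y t] //=.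
  move=> _ _ _; exists (fun x => enum_val (cast_ord eqTV (enum_rank x))) => //.
  exists (fun y => enum_val (cast_ord (esym eqTV) (enum_rank y))) => z.
    by rewrite enum_valK cast_ordK enum_rankK.
  by rewrite enum_valK cast_ordKV enum_rankK.
case/andP=> xNs s_uniq /andP[yNt t_uniq] [eq_sz].
have [f f_bij fst] := IHs t s_uniq t_uniq eq_sz.
exists (tperm (f x) y \o f) => [|/=].
  exact: bij_comp (injF_bij (@perm_inj _ _)) f_bij.
rewrite tpermL; congr cons; rewrite map_comp fst -[RHS]map_id.
apply/eq_in_map => z zt; rewrite tpermD //; last by apply: contraNneq yNt => ->.
apply: contraNneq xNs => fxz; move: zt; rewrite -fxz -fst mem_map //.
exact: bij_inj.
Qed.

Lemma card_prodIdx (m : nat) (p : 'I_m -> nat) : #|prodIdx p| = (\prod_j p j)%N.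
Proof.
rewrite -(bij_eq_card (@dffun_of_fprod_bij _ (fun j => 'I_(p j)))) card_fprod.
by apply: eq_bigr => j _; rewrite card_ord.
Qed.

(** * The grid around a vertex, and exchanges of labels *)

(** The complement of the row and the column of [a], in the grid whose row index is the coordinate
    [j0] and whose column index is the tuple of all other coordinates. *)
Definition off_cross (m : nat) (p : 'I_m -> nat) (j0 : 'I_m) (a : prodIdx p) :
  {set prodIdx p} :=
  [set b : prodIdx p | (b j0 != a j0) && [exists j, (j != j0) && (b j != a j)]].

Lemma off_cross_id (m : nat) (p : 'I_m -> nat) (j0 : 'I_m) (a : prodIdx p) :
  a \notin off_cross j0 a.
Proof. by rewrite inE eqxx. Qed.

Lemma off_cross_col (m : nat) (p : 'I_m -> nat) (j0 : 'I_m) (a b : prodIdx p) :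
  with_coord j0 a b \notin off_cross j0 a.
Proof.
rewrite inE negb_and orbC; apply/orP; left; apply/existsPn => j.
by rewrite negb_and negbK ffunE; case: eqP => //=; rewrite eqxx.
Qed.

Lemma off_cross_row (m : nat) (p : 'I_m -> nat) (j0 : 'I_m) (a b : prodIdx p) :
  with_coord j0 b a \notin off_cross j0 a.
Proof. by rewrite inE ffunE !eqxx. Qed.

Lemma with_coord_neq_l (m : nat) (p : 'I_m -> nat) (j0 : 'I_m) (a b : prodIdx p) :
  b \in off_cross j0 a -> with_coord j0 a b != a.
Proof.
rewrite inE => /andP[+ _]; apply: contraNneq => /ffunP/(_ j0).
by rewrite ffunE eqxx => ->.
Qed.

Lemma with_coord_neq_r (m : nat) (p : 'I_m -> nat) (j0 : 'I_m) (a b : prodIdx p) :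
  b \in off_cross j0 a -> with_coord j0 b a != a.
Proof.
rewrite inE => /andP[_ /existsP[j /andP[jj0]]]; apply: contraNneq => /ffunP/(_ j).
by rewrite ffunE (negbTE jj0) => ->.
Qed.

Lemma with_coord_col_row (m : nat) (p : 'I_m -> nat) (j0 : 'I_m)
    (a b b' : prodIdx p) :
  b \in off_cross j0 a -> with_coord j0 a b != with_coord j0 b' a.
Proof.
rewrite inE => /andP[+ _]; apply: contraNneq => /ffunP/(_ j0).
by rewrite !ffunE eqxx => ->.
Qed.

Lemma with_coord_inj (m : nat) (p : 'I_m -> nat) (j0 : 'I_m) (a b b' : prodIdx p) :
  with_coord j0 a b = with_coord j0 a b' ->
  with_coord j0 b a = with_coord j0 b' a -> b = b'.
Proof.
move=> /ffunP col /ffunP row; apply/ffunP => j; have := col j; have := row j.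
by rewrite !ffunE; case: eqP.
Qed.

(** On the right, each pair from the rest of the column and the rest of the row of [a] occurs
    exactly once. Values in [int] allow balances to be subtracted. *)
Definition balanced (m : nat) (p : 'I_m -> nat) (j0 : 'I_m) (a : prodIdx p)
    (f : rel (prodIdx p)) : Prop :=
  \sum_(b in off_cross j0 a) (f a b)%:R = \sum_(b in off_cross j0 a)
     (f (with_coord j0 a b) (with_coord j0 b a))%:R :> int.

(** For [b] on the cross the mixed pair is [(a, b)] or [(b, a)], so by symmetry these terms
    cancel. *)
Lemma balanced_of_sum (m : nat) (p : 'I_m -> nat) (j0 : 'I_m) (a : prodIdx p)
    (f : rel (prodIdx p)) :
  symmetric f ->
  (\sum_b f a b = \sum_b f (with_coord j0 a b) (with_coord j0 b a))%N ->
  balanced j0 a f.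
Proof.
move=> f_sym; rewrite /balanced -!natr_sum => eq_sum; congr _%:R; move: eq_sum.
rewrite (bigID (mem (off_cross j0 a))) /=.
rewrite [RHS](bigID (mem (off_cross j0 a))) /= => /eqP.
rewrite (eq_bigr (fun b => f (with_coord j0 a b) (with_coord j0 b a) : nat)
          (P := fun b => b \notin _)) ?eqn_add2r => [/eqP //|b].
rewrite inE negb_and negbK => /orP[/eqP b0|/existsPn bj].
  congr (nat_of_bool (f _ _)); apply/ffunP => j; rewrite ffunE.
    by case: eqP => // ->; rewrite b0.
  by case: eqP => // ->; rewrite b0.
rewrite f_sym; congr (nat_of_bool (f _ _)); apply/ffunP => j; rewrite ffunE;
  by have := bj j; case: eqP => //= _; rewrite negbK => /eqP.
Qed.

Local Notation swap x y f := (fun s t => f (tperm x y s) (tperm x y t)).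

(** Exchanging [x], in the row of [a], with [u], off the cross, affects the neighbour count of [a]
    only at [u], and the column-row pairs only where the row end is [x]. Subtract the two
    balances. *)
Lemma balanced_swap_row (m : nat) (p : 'I_m -> nat) (j0 : 'I_m) (a u : prodIdx p)
    (f : rel (prodIdx p)) :
  let x := with_coord j0 u a in
  u \in off_cross j0 a -> balanced j0 a f -> balanced j0 a (swap x u f) ->
  (f a u)%:R - (f a x)%:R
  = \sum_(b in off_cross j0 a | with_coord j0 b a == x)
      ((f (with_coord j0 a b) x)%:R - (f (with_coord j0 a b) u)%:R) :> int.
Proof.
move=> x uW; rewrite /balanced => bal bal'.
have W_neq_u b : b \notin off_cross j0 a -> u != b by apply: contraNneq => <-.
have fix_a : tperm x u a = a.
  by rewrite tpermD ?with_coord_neq_r ?W_neq_u ?off_cross_id.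
have fix_col b : b \in off_cross j0 a ->
    tperm x u (with_coord j0 a b) = with_coord j0 a b.
  by move=> bW; rewrite tpermD ?W_neq_u ?off_cross_col // eq_sym with_coord_col_row.
transitivity (\sum_(b in off_cross j0 a)
    ((f a b)%:R - (f a (tperm x u b))%:R) : int).
  rewrite (bigD1 u) //= tpermR big1 ?addr0 // => b /andP[bW bu].
  rewrite tpermD ?subrr // eq_sym //.
  by apply: contraTneq bW => ->; exact: off_cross_row.
rewrite sumrB bal; move: bal'; under eq_bigr do rewrite fix_a.
move=> ->; rewrite -sumrB [RHS]big_mkcondr; apply: eq_bigr => b bW.
rewrite fix_col //; case: eqP => [->|/eqP bx]; first by rewrite tpermL.
by rewrite tpermD ?W_neq_u ?off_cross_row // 1?eq_sym // subrr.
Qed.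

(** Compare [balanced_swap_row] before and after exchanging [s], in the column of [a], with [t], off
    the cross: [a], [x] and [u] stay fixed, so only the summand with column end [s] changes. *)
Lemma balanced_swap_col (m : nat) (p : 'I_m -> nat) (j0 : 'I_m) (a u t : prodIdx p)
    (f : rel (prodIdx p)) :
  let x := with_coord j0 u a in let s := with_coord j0 a u in
  u \in off_cross j0 a -> t \in off_cross j0 a -> u != t ->
  balanced j0 a f -> balanced j0 a (swap x u f) ->
  balanced j0 a (swap s t f) -> balanced j0 a (swap x u (swap s t f)) ->
  (f s x)%:R - (f s u)%:R = (f t x)%:R - (f t u)%:R :> int.
Proof.
move=> x s uW tW ut bal bal_xu bal_st bal_xu_st.
have t_neq b : b \notin off_cross j0 a -> t != b by apply: contraNneq => <-.
have fix_a : tperm s t a = a.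
  by rewrite tpermD ?with_coord_neq_l ?t_neq ?off_cross_id.
have fix_x : tperm s t x = x.
  by rewrite tpermD ?with_coord_col_row ?t_neq ?off_cross_row.
have fix_u : tperm s t u = u.
  rewrite tpermD 1?[t == _]eq_sym //.
  by apply: contraNneq (off_cross_col j0 a u) => su; rewrite -/s su.
have := balanced_swap_row uW bal_st bal_xu_st.
rewrite -/x fix_a fix_x fix_u (balanced_swap_row uW bal bal_xu) -/x.
rewrite (bigD1 u) ?uW ?eqxx //= [RHS](bigD1 u) ?uW ?eqxx //= -/s tpermL.
rewrite [X in _ + X = _](eq_bigr (fun b =>
    (f (tperm s t (with_coord j0 a b)) x)%:R
    - (f (tperm s t (with_coord j0 a b)) u)%:R)); first exact: addIr.
move=> b /andP[/andP[bW /eqP bx] bu].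
rewrite tpermD ?t_neq ?off_cross_col //.
(* Among the [b] with row end [x], only [u] has column end [s]. *)
apply: contraNneq bu => eq_col; by apply/eqP; exact: with_coord_inj (esym eq_col) bx.
Qed.

Definition always_balanced (n m : nat) (p : 'I_m -> nat) (e : rel 'I_n)
    (j0 : 'I_m) (a : prodIdx p) : Prop :=
  forall lab : prodIdx p -> 'I_n, bijective lab ->
    balanced j0 a (fun b c => e (lab b) (lab c)).

Lemma off_cross_neq (m : nat) (p : 'I_m -> nat) (j0 : 'I_m) (a u b : prodIdx p) :
  u \in off_cross j0 a -> b \notin off_cross j0 a -> u != b.
Proof. by move=> uW; apply: contraNneq => <-. Qed.

Lemma always_balanced_quadruple (n m : nat) (p : 'I_m -> nat) (e : rel 'I_n)
    (j0 : 'I_m) (a u t : prodIdx p) (x' u' s' t' : 'I_n) :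
  #|prodIdx p| = n -> always_balanced e j0 a ->
  u \in off_cross j0 a -> t \in off_cross j0 a -> u != t ->
  uniq [:: x'; u'; s'; t'] ->
  (e s' x')%:R - (e s' u')%:R = (e t' x')%:R - (e t' u')%:R :> int.
Proof.
move=> card_n bal uW tW ut uniq'.
pose x := with_coord j0 u a; pose s := with_coord j0 a u.
have uniq_xust : uniq [:: x; u; s; t].
  rewrite /= !inE !negb_or ut [x == u]eq_sym [x == s]eq_sym [x == t]eq_sym.
  rewrite [s == t]eq_sym with_coord_col_row // !(off_cross_neq uW) //;
    by rewrite ?(off_cross_neq tW) ?off_cross_row ?off_cross_col.
have [|lab lab_bij [<- <- <- <-]] := exists_bijection_map _ uniq_xust uniq' erefl.
  by rewrite card_ord.
have tp y z : bijective (lab \o tperm y z).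
  exact: bij_comp lab_bij (injF_bij (@perm_inj _ _)).
have tp2 y z y' z' : bijective (lab \o tperm y z \o tperm y' z').
  exact: bij_comp (tp _ _) (injF_bij (@perm_inj _ _)).
exact: (balanced_swap_col uW tW ut (bal _ lab_bij) (bal _ (tp _ _))
  (bal _ (tp _ _)) (bal _ (tp2 _ _ _ _))).
Qed.

(** By the quadruple lemma, all [k] summands in [balanced_swap_row] equal one difference [d], while
    the left side is [- d]. Hence [(k + 1) d = 0]. *)
Lemma always_balanced_triple (n m : nat) (p : 'I_m -> nat) (e : rel 'I_n)
    (j0 : 'I_m) (a u t : prodIdx p) (v x' u' : 'I_n) :
  #|prodIdx p| = n -> always_balanced e j0 a ->
  u \in off_cross j0 a -> t \in off_cross j0 a -> u != t ->
  uniq [:: v; x'; u'] -> e v x' = e v u'.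
Proof.
move=> card_n bal uW tW ut uniq'.
pose x := with_coord j0 u a.
have uniq_axu : uniq [:: a; x; u].
  rewrite /= !inE !negb_or [a == x]eq_sym [a == u]eq_sym [x == u]eq_sym.
  by rewrite with_coord_neq_r // !(off_cross_neq uW) // ?off_cross_row ?off_cross_id.
have [|lab lab_bij [<- <- <-]] := exists_bijection_map _ uniq_axu uniq' erefl.
  by rewrite card_ord.
have := balanced_swap_row uW (bal _ lab_bij)
  (bal _ (bij_comp lab_bij (injF_bij (@perm_inj _ (tperm x u))))).
rewrite -/x (eq_bigr (fun=> (e (lab a) (lab x))%:R - (e (lab a) (lab u))%:R)).
  rewrite sumr_const => /eqP; rewrite -opprB eq_sym -subr_eq0 opprK -mulrSr.
  rewrite mulrn_eq0 /= subr_eq0.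
  by case: (e _ _); case: (e _ _).
move=> b /andP[bW _].
apply: (always_balanced_quadruple card_n bal uW tW ut).
pose q := [:: x; u; with_coord j0 a b; a].
rewrite -[X in uniq X]/(map lab q) (map_inj_uniq (bij_inj lab_bij)) /= !inE !negb_or.
rewrite [x == u]eq_sym [x == with_coord _ _ _]eq_sym with_coord_col_row //.
by rewrite with_coord_neq_r // with_coord_neq_l // !(off_cross_neq uW) //
  ?off_cross_row ?off_cross_id ?off_cross_col.
Qed.

(** * Graphs balanced under every labeling *)

(** Adjacency to a fixed vertex is constant, so an end [v] of one edge is adjacent to everything;
    every other vertex is then adjacent to [v], hence to everything. *)
Lemma always_balanced_complete (n m : nat) (p : 'I_m -> nat) (e : rel 'I_n)
    (j0 : 'I_m) (a u t : prodIdx p) :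
  #|prodIdx p| = n -> simple_graph e -> nonempty_graph e ->
  always_balanced e j0 a ->
  u \in off_cross j0 a -> t \in off_cross j0 a -> u != t ->
  complete_graph e.
Proof.
move=> card_n [e_sym e_irr] [v [w evw]] bal uW tW ut.
have vw : v != w by apply: contraTneq evw => ->; rewrite e_irr.
have triple := always_balanced_triple card_n bal uW tW ut.
have v_adj y : y != v -> e v y.
  move=> yv; have [->//|yw] := eqVneq y w.
  by rewrite (triple v y w) // /= !inE negb_or (eq_sym v y) yv vw yw.
move=> x y xy; have [xv|xv] := eqVneq x v; first by rewrite xv v_adj // -xv eq_sym.
have [yv|yv] := eqVneq y v; first by rewrite yv e_sym v_adj.
by rewrite (triple x y v) ?(e_sym x v) ?v_adj //= !inE negb_or xy xv yv.
Qed.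

(** On four vertices: each of the three perfect matchings of the complete graph lies wholly inside
    or wholly outside the graph. *)
Definition opposite_edges (V : eqType) (e : rel V) : Prop :=
  forall v w x y : V, uniq [:: v; w; x; y] -> e v w = e x y.

Lemma always_balanced_opposite_edges (n m : nat) (p : 'I_m -> nat)
    (e : rel 'I_n) (j0 : 'I_m) (a u : prodIdx p) :
  #|prodIdx p| = n -> always_balanced e j0 a -> off_cross j0 a = [set u] ->
  opposite_edges e.
Proof.
move=> card_n bal Wu v w x' y' uniq'.
have uW : u \in off_cross j0 a by rewrite Wu set11.
have uniq_ausx : uniq [:: a; u; with_coord j0 a u; with_coord j0 u a].
  rewrite /= !inE !negb_or [a == u]eq_sym ![a == with_coord _ _ _]eq_sym.
  by rewrite with_coord_col_row // with_coord_neq_r // with_coord_neq_l //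
    !(off_cross_neq uW) // ?off_cross_row ?off_cross_id ?off_cross_col.
have [|lab lab_bij [<- <- <- <-]] := exists_bijection_map _ uniq_ausx uniq' erefl.
  by rewrite card_ord.
have := bal _ lab_bij; rewrite /balanced Wu !big_set1.
by case: (e _ _); case: (e _ _).
Qed.

Lemma separable_always_balanced (n m : nat) (p : 'I_m -> nat) (e : rel 'I_n)
    (j0 : 'I_m) (a : prodIdx p) :
  simple_graph e -> nonempty_graph e ->
  (forall lab : prodIdx p -> 'I_n, bijective lab ->
     separable (labeled_op lab (normalized_laplacian e))) ->
  always_balanced e j0 a.
Proof.
move=> e_simple e_ne sep lab lab_bij; apply: balanced_of_sum.
  by move=> b c; case: e_simple => ->.
exact: separable_degree (sep _ lab_bij).
Qed.

Lemma off_cross_cases (m : nat) (p : 'I_m.+2 -> nat) :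
  (forall j, 2 <= p j)%N ->
  exists a u : prodIdx p, u \in off_cross ord0 a /\
    ((exists2 t, t \in off_cross ord0 a & u != t) \/
     off_cross ord0 a = [set u] /\ (\prod_j p j)%N = 4%N).
Proof.
move=> p_ge2.
pose mk (F : 'I_m.+2 -> nat) (F_lt : forall j, (F j < p j)%N) : prodIdx p :=
  [ffun j => Ordinal (F_lt j)].
have p_gt0 j : (0 < p j)%N := ltnW (p_ge2 j).
(* The corner with all coordinates [0], and the point with all coordinates [1]. *)
pose a := mk (fun=> 0) p_gt0; pose u := mk (fun=> 1) p_ge2.
pose j1 : 'I_m.+2 := lift ord0 ord0.
have in_off (b : prodIdx p) : b ord0 != 0 :> nat -> b j1 != 0 :> nat ->
    b \in off_cross ord0 a.
  move=> b0 b1; rewrite inE ffunE b0; apply/existsP; exists j1.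
  by rewrite ffunE b1.
have uW : u \in off_cross ord0 a by apply: in_off; rewrite ffunE.
exists a, u; split=> //.
have [/existsP[j pj]|/existsPn p_le2] := boolP [exists j, (2 < p j)%N].
  (* A factor of dimension above 2 gives a second point: change the coordinate [j] of [u] to [2]. *)
  left; have F_lt i : ((if i == j then 2 else 1) < p i)%N by case: eqP => [->|_].
  exists (mk _ F_lt); first by apply: in_off; rewrite ffunE /=; case: ifP.
  by apply/eqP => /(congr1 (fun b : prodIdx p => val (b j))); rewrite !ffunE /= eqxx.
have p2 j : p j = 2%N by apply/eqP; rewrite eqn_leq p_ge2 leqNgt p_le2.
case: m => [|m] in p p_ge2 mk p_gt0 a u j1 in_off uW p_le2 p2 *; last first.
  (* With three or more factors the second point is [(1, 1, 0, ..., 0)]. *)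
  left; have F_lt (i : 'I_m.+3) : ((i < 2) < p i)%N by rewrite p2; case: (i < 2)%N.
  exists (mk _ F_lt); first by apply: in_off; rewrite ffunE.
  pose j2 : 'I_m.+3 := lift ord0 (lift ord0 ord0).
  by apply/eqP => /(congr1 (fun b : prodIdx p => val (b j2))); rewrite !ffunE.
right; split; last by rewrite !big_ord_recl big_ord0 !p2.
apply/setP => b; rewrite in_set1; apply/idP/eqP => [|-> //].
rewrite inE => /andP[b0 /existsP[j /andP[j_neq0 bj]]]; apply/ffunP => i; apply/val_inj.
have ->/= : val (u i) = 1%N by rewrite ffunE.
have b_lt2 : (b i < 2)%N by apply: leq_trans (ltn_ord _) _; rewrite p2.
have : b i != 0 :> nat.
  have [->|i0] := eqVneq i ord0; first by move: b0; rewrite ffunE.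
  have -> : i = j.
    apply/val_inj; move: (ltn_ord i) (ltn_ord j) i0 j_neq0.
    by rewrite -!val_eqE /=; lia.
  by move: bj; rewrite ffunE.
by move: b_lt2; case: (nat_of_ord (b i)) => [|[]].
Qed.

(** * Classification on four vertices *)

Lemma isomorphic_by_table (e f : rel 'I_4) (s : seq nat) :
  let g := nth 0%N s in
  (forall i, i < 4 -> g i < 4 /\ g (g i) = i)%N ->
  (forall x y : 'I_4, e (inord (g x)) (inord (g y)) = f x y) -> isomorphic e f.
Proof.
move=> g gP efg; exists (fun x => inord (g x)); split=> //; apply: inv_bij => x.
by apply/val_inj; have [g_lt gK] := gP x (ltn_ord x); rewrite /= !inordK ?gK.
Qed.

Lemma opposite_edges_4 (e : rel 'I_4) :
  simple_graph e -> nonempty_graph e -> opposite_edges e ->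
  complete_graph e \/ isomorphic e K22 \/ isomorphic e coK22.
Proof.
move=> [e_sym e_irr] e_ne opp.
pose E i j := e (inord i) (inord j).
have eE x y : e x y = E x y by rewrite /E !inord_val.
have EC i j : E i j = E j i by rewrite /E e_sym.
have EE i : E i i = false by rewrite /E e_irr.
have oppE i j k l : all (fun i => i < 4)%N [:: i; j; k; l] ->
    uniq [:: i; j; k; l] -> E i j = E k l.
  move=> /and5P[i4 j4 k4 l4 _] u; apply: opp.
  by rewrite -(map_inj_uniq val_inj) /= !inordK.
(* The whole graph is now determined by [E 0 1], [E 0 2] and [E 0 3], one value per perfect
   matching. *)
have E23 : E 2 3 = E 0 1 by apply: oppE.
have E13 : E 1 3 = E 0 2 by apply: oppE.
have E12 : E 1 2 = E 0 3 by apply: oppE.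
have E4 := (E23, E13, E12, EE, EC 1 0, EC 2 0, EC 3 0, EC 2 1, EC 3 1, EC 3 2)%N.
have E_ne : [|| E 0 1, E 0 2 | E 0 3]%N.
  have [x [y]] := e_ne; rewrite eE.
  by case: x => [[|[|[|[|//]]]] ?]; case: y => [[|[|[|[|//]]]] ?] /=;
    rewrite ?E4 // => ->; rewrite ?orbT.
have table : forall s, s \in [:: [:: 0; 1; 2; 3]; [:: 0; 2; 1; 3]; [:: 0; 3; 2; 1]]%N ->
    forall i, (i < 4 -> nth 0 s i < 4 /\ nth 0 s (nth 0 s i) = i)%N.
  by move=> s; rewrite !inE => /or3P[] /eqP->; move=> [|[|[|[|]]]].
case E01: (E 0 1)%N; case E02: (E 0 2)%N; case E03: (E 0 3)%N; last 1 first.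
- by rewrite E01 E02 E03 in E_ne.
- left=> x y; rewrite eE.
  by case: x => [[|[|[|[|//]]]] ?]; case: y => [[|[|[|[|//]]]] ?];
    rewrite /= ?E4 ?E01 ?E02 ?E03.
all: right.
(* Each table sends the pairs 01 and 23 to the exceptional matching: the only absent one for [K22],
   the only present one for [coK22]. *)
all: [> left; apply: (isomorphic_by_table (table [:: 0; 3; 2; 1]%N isT))
      | left; apply: (isomorphic_by_table (table [:: 0; 2; 1; 3]%N isT))
      | right; apply: (isomorphic_by_table (table [:: 0; 1; 2; 3]%N isT))
      | left; apply: (isomorphic_by_table (table [:: 0; 1; 2; 3]%N isT))
      | right; apply: (isomorphic_by_table (table [:: 0; 2; 1; 3]%N isT))
      | right; apply: (isomorphic_by_table (table [:: 0; 3; 2; 1]%N isT))].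
all: move=> x y; rewrite -/(E _ _).
all: case: x => [[|[|[|[|//]]]] ?]; case: y => [[|[|[|[|//]]]] ?];
  by rewrite /= ?E4 ?E01 ?E02 ?E03.
Qed.

Lemma always_separable_graph (n m : nat) (p : 'I_m -> nat) (e : rel 'I_n) :
  (2 <= m)%N -> (forall j, 2 <= p j)%N -> n = (\prod_(j < m) p j)%N ->
  simple_graph e -> nonempty_graph e ->
  (forall lab : prodIdx p -> 'I_n, bijective lab ->
     separable (labeled_op lab (normalized_laplacian e))) ->
  complete_graph e \/ (n = 4%N /\ opposite_edges e).
Proof.
case: m p => [|[|m]] // p _ p_ge2 nE e_simple e_ne sep.
have card_n : #|prodIdx p| = n by rewrite card_prodIdx.
have [a [u [uW offW]]] := off_cross_cases p_ge2.
have bal := separable_always_balanced ord0 a e_simple e_ne sep.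
case: offW => [[t tW ut]|[Wu p4]]; [left|right].
  exact: always_balanced_complete card_n e_simple e_ne bal uW tW ut.
by split; [rewrite nE|exact: always_balanced_opposite_edges card_n bal Wu].
Qed.

(** * Separability of the complete graph *)

(* With P the projection onto the all-ones vector, this is [s (1 - P) + t P]. *)
Definition iso_state (T : finType) (s t : C) : op T :=
  fun x y => s * ((x == y)%:R - #|T|%:R^-1) + t * #|T|%:R^-1.

(** The eigenvalues are [t] on the all-ones vector and [s] on its orthogonal complement, which has
    dimension [#|T| - 1]. *)
Lemma iso_state_density (T : finType) (s t : C) :
  (0 < #|T|)%N -> 0 <= s -> 0 <= t -> s * (#|T|%:R - 1) + t = 1 ->
  density_matrix (iso_state (T := T) s t).
Proof.
move=> T_gt0 s_ge0 t_ge0 st1.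
have q_neq0 : #|T|%:R != 0 :> C by rewrite pnatr_eq0 -lt0n.
have qV_ge0 : 0 <= #|T|%:R^-1 :> C by rewrite invr_ge0 ler0n.
have conj_ge0 (z : C) : 0 <= z -> z^* = z.
  by move=> z_ge0; apply/CrealP; rewrite ger0_real.
split.
- move=> x y; rewrite /iso_state eq_sym rmorphD !rmorphM rmorphB rmorph_nat /=.
  by rewrite !conj_ge0.
- move=> v; pose S := \sum_x v x.
  (* [w] is the projection of [v] orthogonal to the all-ones vector, which diagonalizes the form. *)
  pose w x := v x - S * #|T|%:R^-1.
  suff -> : \sum_x \sum_y (v x)^* * iso_state s t x y * v y
      = s * \sum_x w x * (w x)^* + t * #|T|%:R^-1 * (S * S^*).
    apply: addr_ge0; last by rewrite mulr_ge0 ?mul_conjC_ge0 ?(mulr_ge0 t_ge0).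
    by rewrite mulr_ge0 // sumr_ge0 // => x _; exact: mul_conjC_ge0.
  have SJ : S^* = \sum_x (v x)^* by rewrite rmorph_sum.
  transitivity (\sum_x (s * (v x * (v x)^*)
      + (t - s) * #|T|%:R^-1 * S * (v x)^*)).
    apply: eq_bigr => x _.
    rewrite -(sum_mul_delta x (fun y => v y * (v x)^*)) mulr_sumr.
    rewrite /S mulr_sumr mulr_suml -big_split /=; apply: eq_bigr => y _.
    by rewrite /iso_state (eq_sym x y); ring.
  rewrite big_split /= -!mulr_sumr -SJ.
  have -> : \sum_x w x * (w x)^*
      = \sum_x v x * (v x)^* - #|T|%:R^-1 * (S * S^*).
    transitivity (\sum_x (v x * (v x)^* - S^* * #|T|%:R^-1 * v x
        - S * #|T|%:R^-1 * (v x)^* + S * S^* * #|T|%:R^-1 ^+ 2)).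
      by apply: eq_bigr => x _; rewrite /w rmorphB rmorphM /= (conj_ge0 _^-1) //; ring.
    rewrite big_split /= !sumrB -!mulr_sumr -SJ -/S sumr_const -mulr_natr.
    by field.
  by ring.
- rewrite /trace /iso_state; under eq_bigr do rewrite eqxx.
  by rewrite sumr_const -[RHS]st1 -[LHS]mulr_natr /=; field.
Qed.

(** Replace the [x j] by the [y j] one at a time from the left; the [i]-th summand is the change
    made by the [i]-th replacement. *)
Lemma prodB_telescope (R : comPzRingType) (m : nat) (x y : 'I_m -> R) :
  \prod_j x j - \prod_j y j
  = \sum_(i < m) \prod_(j < m) (if (j < i)%N then y j
                          else if j == i then x j - y j else x j).
Proof.
elim: m x y => [|m IHm] x y; first by rewrite !big_ord0 subrr.
rewrite [X in X - _]big_ord_recr [X in _ - X]big_ord_recr [RHS]big_ord_recr /=.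
transitivity ((\prod_(j < m) x (widen_ord (leqnSn m) j)
   - \prod_(j < m) y (widen_ord (leqnSn m) j)) * x ord_max
   + \prod_(j < m) y (widen_ord (leqnSn m) j) * (x ord_max - y ord_max)).
  by ring.
rewrite IHm mulr_suml; congr (_ + _).
  apply: eq_bigr => i _; rewrite big_ord_recr /= ltnNge (ltnW (ltn_ord i)) /=.
  by rewrite -val_eqE /= gtn_eqF.
rewrite big_ord_recr /= ltnn eqxx; congr (_ * _).
by apply: eq_bigr => j _; rewrite ltn_ord.
Qed.

Lemma delta_dffun (m : nat) (p : 'I_m -> nat) (a b : prodIdx p) :
  (a == b)%:R = \prod_j (a j == b j)%:R :> C.
Proof.
case: eqP => [->|ab]; first by rewrite big1 // => j _; rewrite eqxx.
have [j abj] : exists j, a j != b j.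
  by apply/existsP; apply: contra_notT ab => /existsPn ab; apply/ffunP => j;
    apply/eqP/negbNE.
by rewrite (bigD1 j) //= (negbTE abj) mul0r.
Qed.

Lemma laplacian_complete (n : nat) (e : rel 'I_n) (x y : 'I_n) :
  irreflexive e -> complete_graph e ->
  laplacian e x y = n%:R * (x == y)%:R - 1.
Proof.
move=> e_irr e_compl; have n_gt0 : (0 < n)%N := leq_ltn_trans (leq0n x) (ltn_ord x).
rewrite /laplacian; case: eqP => [<-|/eqP xy]; last first.
  by rewrite e_compl // mulr0.
rewrite e_irr subr0 mulr1 /degree.
have -> : [set z | e x z] = [set~ x].
  apply/setP => z; rewrite !inE; have [->|zx] := eqVneq z x; first exact: e_irr.
  by rewrite e_compl // eq_sym.
by rewrite cardsC1 card_ord -subn1 natrB.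
Qed.

Lemma complete_separable (n m : nat) (p : 'I_m -> nat) (e : rel 'I_n)
    (lab : prodIdx p -> 'I_n) :
  (forall j, 2 <= p j)%N -> n = (\prod_(j < m) p j)%N ->
  irreflexive e -> nonempty_graph e -> complete_graph e -> bijective lab ->
  separable (labeled_op lab (normalized_laplacian e)).
Proof.
move=> p_ge2 nE e_irr e_ne e_compl lab_bij.
have trE : trace (laplacian e) = n%:R * (n%:R - 1).
  rewrite /trace; under eq_bigr do rewrite laplacian_complete // eqxx mulr1.
  by rewrite sumr_const card_ord mulr_natl.
have := laplacian_trace_neq0 e_irr e_ne; rewrite trE mulf_eq0 negb_or.
move=> /andP[n_neq0 n1_neq0].
have p_neq0 j : (p j)%:R != 0 :> C by rewrite pnatr_eq0 -lt0n ltnW.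
have p1_gt0 j : 0 < (p j)%:R - 1 :> C by rewrite subr_gt0 ltr1n.
have p1_neq0 j : (p j)%:R - 1 != 0 :> C by rewrite gt_eqF.
have nC : n%:R = \prod_j (p j)%:R :> C by rewrite nE natr_prod.
(* In the [i]-th telescoped term the factor at [j] is P, 1 - P or the identity, for [j] below, equal
   to or above [i]. [w i j] is its trace and [A i j] the factor divided by that trace. *)
pose w (i j : 'I_m) : C :=
  if (j < i)%N then 1 else if j == i then (p j)%:R - 1 else (p j)%:R.
have w_gt0 i j : 0 < w i j.
  by rewrite /w; case: ifP => // _; case: ifP => // _; rewrite lt_def p_neq0 ler0n.
pose A (i j : 'I_m) : op 'I_(p j) :=
  if (j < i)%N then iso_state 0 1
  else if j == i then iso_state ((p j)%:R - 1)^-1 0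
  else iso_state (p j)%:R^-1 (p j)%:R^-1.
have sum_w : \sum_i \prod_j w i j = n%:R - 1.
  transitivity (\prod_j (p j)%:R - \prod_(j < m) 1 : C); last by rewrite nC big1_eq.
  by rewrite prodB_telescope.
have n1_gt0 : 0 < n%:R - 1 :> C.
  rewrite lt_def n1_neq0 -sum_w sumr_ge0 // => i _.
  by apply: prodr_ge0 => j _; exact: ltW.
exists m, (fun i => (\prod_j w i j) / (n%:R - 1)), A; split.
- move=> i; rewrite divr_ge0 ?(ltW n1_gt0) //.
  by apply: prodr_ge0 => j _; exact: ltW.
- by rewrite -mulr_suml sum_w divff.
- move=> i j; rewrite /A.
  case: ifP => _; [|case: ifP => _]; apply: iso_state_density;
    rewrite ?card_ord ?invr_ge0 ?ler0n ?ler01 ?(ltW (p1_gt0 j)) ?(ltnW (p_ge2 j)) //.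
  + by rewrite mul0r add0r.
  + by rewrite mulVf ?addr0.
  + by field.
- move=> a b.
  rewrite /labeled_op /normalized_laplacian trE laplacian_complete //.
  rewrite (bij_eq lab_bij).
  (* Both [(a == b)%:R] and [n%:R^-1] are products over the coordinates, so the telescoping applies
     entrywise. *)
  transitivity (((a == b)%:R - n%:R^-1) / (n%:R - 1) : C).
    by field; rewrite n_neq0 n1_neq0.
  rewrite delta_dffun nC -prodfV prodB_telescope mulr_suml; apply: eq_bigr => i _.
  rewrite mulrAC -big_split /=; congr (_ * _); apply: eq_bigr => j _.
  rewrite /w /A /iso_state card_ord.
  case: ifP => _; [|case: ifP => _].
  + by ring.
  + by field; rewrite p1_neq0 p_neq0.
  + by field.
Qed.

(** * Separability on the 2 x 2 grid *)

Lemma isomorphic_opposite_edges (n : nat) (e f : rel 'I_n) :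
  opposite_edges f -> isomorphic e f -> opposite_edges e.
Proof.
move=> f_opp [g [[h gK hK] efg]] v w x y uniq4.
rewrite -(hK v) -(hK w) -(hK x) -(hK y) !efg; apply: f_opp.
by rewrite -(map_inj_uniq (can_inj gK)) /= !hK.
Qed.

Lemma K22_opposite_edges : opposite_edges K22.
Proof.
move=> v w x y; rewrite -(map_inj_uniq val_inj) /= /K22.
case: v => [[|[|[|[|//]]]] ?]; case: w => [[|[|[|[|//]]]] ?] //=;
  by case: x => [[|[|[|[|//]]]] ?]; case: y => [[|[|[|[|//]]]] ?].
Qed.

Lemma coK22_opposite_edges : opposite_edges coK22.
Proof.
move=> v w x y; rewrite -(map_inj_uniq val_inj) /= /coK22 -!val_eqE.
case: v => [[|[|[|[|//]]]] ?]; case: w => [[|[|[|[|//]]]] ?] //=;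
  by case: x => [[|[|[|[|//]]]] ?]; case: y => [[|[|[|[|//]]]] ?].
Qed.

Lemma opposite_edges_cast (n : nat) (e : rel 'I_n) (h4 : n = 4%N) :
  opposite_edges (fun x y : 'I_4 =>
    e (cast_ord (esym h4) x) (cast_ord (esym h4) y)) -> opposite_edges e.
Proof.
move=> opp v w x y uniq4.
have := opp (cast_ord h4 v) (cast_ord h4 w) (cast_ord h4 x) (cast_ord h4 y).
rewrite !cast_ordK; apply.
by rewrite -(map_inj_uniq (can_inj (cast_ordKV h4))) /= !cast_ordK.
Qed.

Lemma prod_eq4 (m : nat) (p : 'I_m -> nat) :
  (2 <= m)%N -> (forall j, 2 <= p j)%N -> (\prod_j p j)%N = 4%N ->
  m = 2%N /\ forall j, p j = 2%N.
Proof.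
case: m p => [|[|[|m]]] // p _ p_ge2.
  rewrite !big_ord_recl big_ord0 muln1 => p4.
  have p0 := p_ge2 ord0; have p1 := p_ge2 (lift ord0 ord0).
  have [p0E p1E] : p ord0 = 2%N /\ p (lift ord0 ord0) = 2%N by nia.
  split=> // j; case: (unliftP ord0 j) => [j' ->|-> //].
  by rewrite (ord1 j').
rewrite !big_ord_recl => p4.
have p0 := p_ge2 ord0; have p1 := p_ge2 (lift ord0 ord0).
have p2 := p_ge2 (lift ord0 (lift ord0 ord0)).
have : (0 < \prod_(j < m) p (lift ord0 (lift ord0 (lift ord0 j))))%N.
  by apply: prodn_gt0 => j; apply: ltnW.
move=> r_gt0; have := leq_mul p0 (leq_mul p1 (leq_mul p2 r_gt0)).
by rewrite p4.
Qed.

Lemma opposite_edges_separable (n m : nat) (p : 'I_m -> nat) (e : rel 'I_n)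
    (lab : prodIdx p -> 'I_n) :
  m = 2%N -> (forall j, p j = 2%N) -> simple_graph e -> nonempty_graph e ->
  opposite_edges e -> bijective lab ->
  separable (labeled_op lab (normalized_laplacian e)).
Proof.
move=> m2; case: _ / (esym m2) in p lab *.
move=> p2 [e_sym e_irr] e_ne opp lab_bij.
(* Grid points are encoded as pairs of booleans, so that the remaining identities become finite case
   checks. *)
pose coord (u : bool * bool) (j : 'I_2) : nat := if j == ord0 then u.1 else u.2.
have coord_lt u j : (coord u j < p j)%N.
  by rewrite p2 /coord; case: ifP => _; exact: leq_b1.
pose dec u : prodIdx p := [ffun j => Ordinal (coord_lt u j)].
pose j1 : 'I_2 := lift ord0 ord0.
pose code (a : prodIdx p) : bool * bool := (val (a ord0) == 1%N, val (a j1) == 1%N).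
have decK : cancel dec code.
  by move=> [[] []]; rewrite /code !ffunE.
have codeK : cancel code dec.
  move=> a; apply/ffunP => j; apply/val_inj; rewrite ffunE /= /coord /code /=.
  have a_lt2 i : (a i < 2)%N by apply: leq_trans (ltn_ord _) _; rewrite p2.
  have [->|j_neq0] := eqVneq j ord0; first by case: (val _) (a_lt2 ord0) => [|[]].
  have -> : j = j1.
    apply/val_inj; move: (ltn_ord j) j_neq0.
    by rewrite -val_eqE /=; case: (val j) => [|[]].
  by case: (val _) (a_lt2 j1) => [|[]].
pose v u := lab (dec u).
have v_bij : bijective v by apply: bij_comp lab_bij _; exists code.
pose f u w := e (v u) (v w).
have f_sym u w : f u w = f w u by rewrite /f e_sym.
have f_irr u : f u u = false by rewrite /f e_irr.
have f_opp w x y z : uniq [:: w; x; y; z] -> f w x = f y z.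
  by move=> u4; apply: opp; rewrite -(map_inj_uniq (bij_inj v_bij)) in u4.
(* [al], [be] and [ga] tell which matchings are present: ends differing in the second coordinate, in
   the first, or in both. *)
pose al := f (false, false) (false, true); pose be := f (false, false) (true, false).
pose ga := f (false, false) (true, true).
have fE u w : f u w = if u.1 == w.1 then (u.2 != w.2) && al
                      else if u.2 == w.2 then be else ga.
  rewrite /al /be /ga.
  by case: u => [[] []]; case: w => [[] []]; rewrite //= ?f_irr //;
    first [exact: f_sym | exact: f_opp | rewrite f_sym; exact: f_opp].
have degE u : degree e (v u) = (al + be + ga)%N.
  rewrite degreeE (reindex v) /=; last exact/onW_bij.
  under eq_bigr do rewrite -/(f _ _) fE.
  rewrite -(pair_bigA _ (fun x y => nat_of_bool (if u.1 == x then (u.2 != y) && al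
                      else if u.2 == y then be else ga))) /=.
  rewrite !big_bool /=.
  by case: u => [[] []] /=; lia.
pose s : C := al%:R + be%:R + ga%:R.
have trE : trace (laplacian e) = 4%:R * s.
  rewrite laplacian_trace // (reindex v) /=; last exact/onW_bij.
  under eq_bigr do rewrite degE.
  by rewrite sum_nat_const card_prod card_bool natrM !natrD.
have s_neq0 : s != 0.
  have := laplacian_trace_neq0 e_irr e_ne.
  by rewrite trE mulf_eq0 negb_or => /andP[].
have s_ge0 : 0 <= s by rewrite !addr_ge0 ?ler0n.
(* The matching of [ga] needs two product states, P (x) Q and Q (x) P, which share its weight
   equally. *)
pose c (i : 'I_4) : C :=
  nth 0 [:: al%:R / s; be%:R / s; ga%:R / (2 * s); ga%:R / (2 * s)] i.
(* In dimension 2 the values [2^-1], [1] and [0] make [iso_state (t i j) (1 - t i j)] half the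
   identity, Q and P respectively. *)
pose t (i : 'I_4) (j : 'I_2) : C :=
  nth 0 (if j == ord0 then [:: 2^-1; 1; 0; 1] else [:: 1; 2^-1; 1; 0]) i.
exists 4, c, (fun i j => iso_state (t i j) (1 - t i j)); split.
- by case=> [[|[|[|[|//]]]] ?]; rewrite /c /= divr_ge0 ?mulr_ge0 ?ler0n.
- by rewrite !big_ord_recr big_ord0 /c /=; rewrite /s in s_neq0 *; field.
- move=> i j; have [t_ge0 t_le1] : 0 <= t i j /\ t i j <= 1.
    have h0 : 0 <= 2^-1 :> C by rewrite invr_ge0 ler0n.
    have h1 : 2^-1 <= 1 :> C by rewrite invf_le1 ?ler1n ?ltr0n.
    by rewrite /t; case: ifP => _; case: i => [[|[|[|[|//]]]] ?] /=;
      rewrite ?ler01 ?lexx.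
  apply: iso_state_density; rewrite ?card_ord ?p2 ?subr_ge0 //.
  by ring.
- move=> a b; rewrite -(codeK a) -(codeK b).
  move: (code a) (code b) => {a b} u w.
  rewrite !big_ord_recr big_ord0 /labeled_op /normalized_laplacian trE.
  rewrite -/(v u) -/(v w) /laplacian (bij_eq v_bij) degE -/(f u w) fE !natrD.
  rewrite /tens !big_ord_recr !big_ord0.
  have stE i j : iso_state (t i j) (1 - t i j) (dec u j) (dec w j)
      = t i j * ((coord u j == coord w j)%:R - 2^-1) + (1 - t i j) * 2^-1.
    by rewrite /iso_state -val_eqE !ffunE /= card_ord p2.
  rewrite !stE /c /t /coord -/s.
  case: u {stE} => [[] []]; case: w => [[] []] /=; rewrite /s in s_neq0 *.
  all: by field.
Qed.

(** * The characterization of graphs separable under every labeling *)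

Theorem theorem3 (n m : nat) (p : 'I_m -> nat) (e : rel 'I_n) :
  (2 <= m)%N -> (forall j, 2 <= p j)%N -> n = (\prod_(j < m) p j)%N ->
  simple_graph e -> nonempty_graph e ->
  (forall lab : prodIdx p -> 'I_n, bijective lab ->
     separable (labeled_op lab (normalized_laplacian e)))
  <-> (complete_graph e \/
       exists h4 : n = 4%N,
         isomorphic (fun x y : 'I_4 => e (cast_ord (esym h4) x) (cast_ord (esym h4) y)) K22 \/
         isomorphic (fun x y : 'I_4 => e (cast_ord (esym h4) x) (cast_ord (esym h4) y)) coK22).
Proof.
move=> m_ge2 p_ge2 nE e_simple e_ne; split.
  case/(always_separable_graph m_ge2 p_ge2 nE e_simple e_ne); first by left.
  case=> n4; case: _ / (esym n4) in e e_simple e_ne * => opp.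
  have [|iso] := opposite_edges_4 e_simple e_ne opp; [by left|right].
  by exists (erefl 4); case: iso => -[g [g_bij efg]]; [left|right];
    exists g; split=> // x y; rewrite !cast_ord_id efg.
move=> e_graph lab lab_bij.
case: e_graph => [e_compl|[h4 iso]].
  exact: complete_separable p_ge2 nE (proj2 e_simple) e_ne e_compl lab_bij.
have [m2 p2] := prod_eq4 m_ge2 p_ge2 (etrans (esym nE) h4).
apply: opposite_edges_separable m2 p2 e_simple e_ne _ lab_bij.
apply: (opposite_edges_cast (h4 := h4)); case: iso.
  exact/isomorphic_opposite_edges/K22_opposite_edges.
exact/isomorphic_opposite_edges/coK22_opposite_edges.
Qed.
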